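(* Let $n\ge 1$ and let $R_n(w)=\sum_{m=0}^{n}A_m w^m$ be a right quaternionic polynomial with coefficients $A_m\in\mathbb{H}$, $A_n\neq 0$. Let $\{w_1,\dots,w_n\}$ be a set of roots of $R_n$, taken with multiplicity. Then $$\prod_{m=1}^{n}|w_m|=\frac{|A_0|}{|A_n|}.$$
   Context: $\mathbb{H}=\{x_0+x_1i+x_2j+x_3k : x_0,\dots,x_3\in\mathbb{R}\}$ is the skew field of real quaternions, $i^2=j^2=k^2=-1$, $ij=-ji=k$, $jk=-kj=i$, $ki=-ik=j$. For $w=x_0+x_1i+x_2j+x_3k$ put $\mathrm{Sc}(w)=x_0$, $\mathrm{Vec}(w)=x_1i+x_2j+x_3k$, $\overline{w}=x_0-x_1i-x_2j-x_3k$, $|w|=\sqrt{x_0^2+x_1^2+x_2^2+x_3^2}$. Basic polynomial of $R_n$: the polynomial of a complex variable $$F^*_{2n}(z)=\sum_{m=0}^{2n}\Big(\sum_{d+r=m,\ 0\le d,r\le n}\overline{A}_dA_r\Big)z^m.$$ Its coefficients are real and its degree is $2n$. A root of $R_n$ is $w\in\mathbb{H}$ with $\sum_{m=0}^n A_mw^m=0$. A root $w$ with $|\mathrm{Vec}(w)|=r>0$ is spherical if every quaternion $w'$ with $\mathrm{Sc}(w')=\mathrm{Sc}(w)$ and $|\mathrm{Vec}(w')|=r$ is also a root; the whole sphere of such $w'$ is then counted as one spherical root. The other roots are isolated. Multiplicity: the multiplicity of an isolated or spherical root $w$ of $R_n$ is the multiplicity, as a root of $F^*_{2n}$, of the complex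 number $z$ (equivalently $\overline{z}$) with $\mathrm{Re}\,z=\mathrm{Sc}(w)$, $|\mathrm{Im}\,z|=|\mathrm{Vec}(w)|$; if $z$ is real, the multiplicity of $w$ is half the multiplicity of $z$. Set of roots: a list $\{w_1,\dots,w_n\}$ containing each isolated root as many times as its multiplicity and, for each spherical root of multiplicity $k$, containing $k$ arbitrary quaternions chosen from that sphere. With multiplicity, the total number of roots is exactly $n$. *)

(* Defs.v *)
From HB Require Import structures.
From mathcomp Require Import all_boot all_order all_algebra.
From mathcomp Require Import complex ring lra.
From mathcomp Require Import reals.

Set Implicit Arguments.
Unset Strict Implicit.
Unset Printing Implicit Defensive.

Import Order.TTheory GRing.Theory Num.Theory.
Local Open Scope ring_scope.
Local Open Scope complex_scope.

(** [Quat x0 x1 x2 x3] is x0 + x1 i + x2 j + x3 k. *)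
Record quat (R : Type) := Quat { qx0 : R; qx1 : R; qx2 : R; qx3 : R }.

Definition quat_tuple (R : Type) (w : quat R) : R * R * R * R :=
  (qx0 w, qx1 w, qx2 w, qx3 w).
Definition tuple_quat (R : Type) (t : R * R * R * R) : quat R :=
  let: (a, b, c, d) := t in Quat a b c d.
Lemma quat_tupleK (R : Type) : cancel (@quat_tuple R) (@tuple_quat R).
Proof. by case. Qed.

HB.instance Definition _ (R : choiceType) :=
  Choice.copy (quat R) (can_type (@quat_tupleK R)).

Section QuatRing.
Variable R : comNzRingType.
Implicit Types u v w : quat R.

Lemma quatP u v : qx0 u = qx0 v -> qx1 u = qx1 v -> qx2 u = qx2 v ->
  qx3 u = qx3 v -> u = v.
Proof. by case: u v => [? ? ? ?] [? ? ? ?] /= -> -> -> ->. Qed.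

Definition quat0 : quat R := Quat 0 0 0 0.
Definition quat_opp u := Quat (- qx0 u) (- qx1 u) (- qx2 u) (- qx3 u).
Definition quat_add u v :=
  Quat (qx0 u + qx0 v) (qx1 u + qx1 v) (qx2 u + qx2 v) (qx3 u + qx3 v).

Lemma quat_addA : associative quat_add.
Proof. by move=> u v w; apply: quatP; rewrite /= addrA. Qed.
Lemma quat_addC : commutative quat_add.
Proof. by move=> u v; apply: quatP; rewrite /= addrC. Qed.
Lemma quat_add0 : left_id quat0 quat_add.
Proof. by move=> u; apply: quatP; rewrite /= add0r. Qed.
Lemma quat_addN : left_inverse quat0 quat_opp quat_add.
Proof. by move=> u; apply: quatP; rewrite /= addNr. Qed.

HB.instance Definition _ :=
  GRing.isZmodule.Build (quat R) quat_addA quat_addC quat_add0 quat_addN.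

Definition quat1 : quat R := Quat 1 0 0 0.
Definition quat_mul u v := Quat
  (qx0 u * qx0 v - qx1 u * qx1 v - qx2 u * qx2 v - qx3 u * qx3 v)
  (qx0 u * qx1 v + qx1 u * qx0 v + qx2 u * qx3 v - qx3 u * qx2 v)
  (qx0 u * qx2 v - qx1 u * qx3 v + qx2 u * qx0 v + qx3 u * qx1 v)
  (qx0 u * qx3 v + qx1 u * qx2 v - qx2 u * qx1 v + qx3 u * qx0 v).

Lemma quat_mulA : associative quat_mul.
Proof. by move=> u v w; apply: quatP => /=; ring. Qed.
Lemma quat_mul1l : left_id quat1 quat_mul.
Proof. by move=> u; apply: quatP => /=; ring. Qed.
Lemma quat_mul1r : right_id quat1 quat_mul.
Proof. by move=> u; apply: quatP => /=; ring. Qed.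
Lemma quat_mulDl : left_distributive quat_mul quat_add.
Proof. by move=> u v w; apply: quatP => /=; ring. Qed.
Lemma quat_mulDr : right_distributive quat_mul quat_add.
Proof. by move=> u v w; apply: quatP => /=; ring. Qed.
Lemma quat1_neq0 : quat1 != 0.
Proof. by apply/eqP => -[] /eqP; rewrite oner_eq0. Qed.

HB.instance Definition _ := GRing.Zmodule_isNzRing.Build (quat R)
  quat_mulA quat_mul1l quat_mul1r quat_mulDl quat_mulDr quat1_neq0.

Definition qi : quat R := Quat 0 1 0 0.
Definition qj : quat R := Quat 0 0 1 0.
Definition qk : quat R := Quat 0 0 0 1.

Lemma quat_rels :
  [/\ [/\ qi * qi = -1, qj * qj = -1 & qk * qk = -1],
      qi * qj = qk /\ qj * qi = - qk,
      qj * qk = qi /\ qk * qj = - qi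
    & qk * qi = qj /\ qi * qk = - qj].
Proof. by do !split; apply: quatP => /=; ring. Qed.

Definition Sc w : R := qx0 w.
Definition Vec w : quat R := Quat 0 (qx1 w) (qx2 w) (qx3 w).
Definition qconj w : quat R := Quat (qx0 w) (- qx1 w) (- qx2 w) (- qx3 w).

Lemma qx0D u v : qx0 (u + v) = qx0 u + qx0 v. Proof. by []. Qed.
Lemma qx1D u v : qx1 (u + v) = qx1 u + qx1 v. Proof. by []. Qed.
Lemma qx2D u v : qx2 (u + v) = qx2 u + qx2 v. Proof. by []. Qed.
Lemma qx3D u v : qx3 (u + v) = qx3 u + qx3 v. Proof. by []. Qed.
Lemma qx0_sum (I : Type) (s : seq I) (P : pred I) (F : I -> quat R) :
  qx0 (\sum_(i <- s | P i) F i) = \sum_(i <- s | P i) qx0 (F i).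
Proof. exact: (big_morph _ qx0D (erefl _)). Qed.
Lemma qx1_sum (I : Type) (s : seq I) (P : pred I) (F : I -> quat R) :
  qx1 (\sum_(i <- s | P i) F i) = \sum_(i <- s | P i) qx1 (F i).
Proof. exact: (big_morph _ qx1D (erefl _)). Qed.
Lemma qx2_sum (I : Type) (s : seq I) (P : pred I) (F : I -> quat R) :
  qx2 (\sum_(i <- s | P i) F i) = \sum_(i <- s | P i) qx2 (F i).
Proof. exact: (big_morph _ qx2D (erefl _)). Qed.
Lemma qx3_sum (I : Type) (s : seq I) (P : pred I) (F : I -> quat R) :
  qx3 (\sum_(i <- s | P i) F i) = \sum_(i <- s | P i) qx3 (F i).
Proof. exact: (big_morph _ qx3D (erefl _)). Qed.

End QuatRing.

Section QuatPoly.
Variable R : realType.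
Implicit Types (w : quat R) (p : {poly quat R}).

Definition qnorm w : R :=
  Num.sqrt (qx0 w ^+ 2 + qx1 w ^+ 2 + qx2 w ^+ 2 + qx3 w ^+ 2).

(** A right polynomial R_n(w) = \sum_(m <= n) A_m w^m with A_n <> 0 is
    [p : {poly quat R}] with [size p = n.+1] and A_m = [p`_m]: over a
    noncommutative ring [p.[w]] keeps the coefficients to the left of the powers
    of [w] ([horner_coef]). Accordingly [root p w] means R_n(w) = 0. *)

Definition basic_coef p (m : nat) : quat R :=
  \sum_(d < size p) \sum_(r < size p | (d + r)%N == m) qconj p`_d * p`_r.

(** [Sc] only retypes the coefficients, which are real: [basic_coef_real]. *)
Definition basic_poly p : {poly R[i]} :=
  \poly_(m < ((size p).-1).*2.+1) (Sc (basic_coef p m))%:C.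

Definition spherical_root p w : Prop :=
  [/\ root p w, 0 < qnorm (Vec w)
    & forall w', Sc w' = Sc w -> qnorm (Vec w') = qnorm (Vec w) -> root p w'].

Definition isolated_root p w : Prop := root p w /\ ~ spherical_root p w.

Definition root_to_complex w : R[i] := Sc w +i* qnorm (Vec w).

(** The halving is exact: [mup_basic_poly_real_even]. *)
Definition root_mult p w : nat :=
  if qnorm (Vec w) == 0 then (mup (root_to_complex w) (basic_poly p))./2
  else mup (root_to_complex w) (basic_poly p).

Definition on_sphere w w' : bool :=
  (Sc w' == Sc w) && (qnorm (Vec w') == qnorm (Vec w)).

Definition set_of_roots p (ws : seq (quat R)) : Prop :=
  [/\ forall w, w \in ws -> root p w,
      forall w, isolated_root p w -> count_mem w ws = root_mult p w
    & forall w, spherical_root p w -> count (on_sphere w) ws = root_mult p w].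

Lemma basic_coef_real p m : Vec (basic_coef p m) = 0.
Proof.
have sym (f : 'I_(size p) -> 'I_(size p) -> R) :
    (forall d r, f d r = - f r d) ->
    \sum_(d < size p) \sum_(r < size p | (d + r)%N == m) f d r = 0.
  move=> fN; set S := (X in X = 0).
  suff: S = - S by move=> e; lra.
  rewrite {1}/S (exchange_big_dep xpredT) //= -sumrN; apply: eq_bigr => d _.
  rewrite -sumrN; apply: eq_big => [r|r _]; by [rewrite addnC | rewrite fN].
apply: quatP => //=; rewrite /basic_coef ?(qx1_sum, qx2_sum, qx3_sum).
- under eq_bigr do rewrite qx1_sum.
  by apply: (sym (fun d r => qx1 (qconj p`_d * p`_r))) => d r /=; ring.
- under eq_bigr do rewrite qx2_sum.
  by apply: (sym (fun d r => qx2 (qconj p`_d * p`_r))) => d r /=; ring.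
- under eq_bigr do rewrite qx3_sum.
  by apply: (sym (fun d r => qx3 (qconj p`_d * p`_r))) => d r /=; ring.
Qed.

Definition qcomp (p : {poly quat R}) (l : 'I_4) : {poly R} :=
  \poly_(m < size p)
    nth 0 [:: qx0 p`_m; qx1 p`_m; qx2 p`_m; qx3 p`_m] l.

Lemma basic_poly_sqr p :
  basic_poly p = map_poly (real_complex R) (\sum_l qcomp p l ^+ 2).
Proof.
apply/polyP => m; rewrite coef_map coef_poly /=.
have -> : (\sum_l qcomp p l ^+ 2)`_m = Sc (basic_coef p m).
  rewrite coef_sum /Sc /basic_coef qx0_sum.
  under [RHS]eq_bigr do rewrite qx0_sum /=.
  have sqE l : (qcomp p l ^+ 2)`_m = \sum_(d < size p)
     \sum_(r < size p | (d + r)%N == m) (qcomp p l)`_d * (qcomp p l)`_r.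
    rewrite expr2 {1 2}/qcomp !poly_def mulr_suml coef_sum; apply: eq_bigr => d _.
    rewrite mulr_sumr coef_sum [RHS]big_mkcond; apply: eq_bigr => r _ /=.
    rewrite -scalerAl -scalerAr !coefZ -exprD coefXn eq_sym /qcomp !coef_poly.
    by rewrite !ltn_ord; case: ifP => _; rewrite ?mulr1 ?mulr0.
  rewrite (eq_bigr _ (fun l _ => sqE l)).
  rewrite exchange_big; apply: eq_bigr => d _ /=.
  rewrite exchange_big; apply: eq_bigr => r _ /=.
  by rewrite !big_ord_recl big_ord0 /= !coef_poly !ltn_ord /=; ring.
case: ifP => // /negbT; rewrite -leqNgt => mp.
rewrite /Sc /basic_coef big1 ?qx0_sum //= => d _; rewrite big1 // => r /eqP drm.
have le_pred (i : 'I_(size p)) : (i <= (size p).-1)%N.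
  by rewrite -ltnS prednK // (leq_ltn_trans (leq0n i)).
by move: mp; rewrite -drm -addnn ltnNge leq_add.
Qed.

Lemma factor_common (x : R) (P : 'I_4 -> {poly R}) : (exists l, P l != 0) ->
  exists k (Q : 'I_4 -> {poly R}),
    (forall l, P l = Q l * ('X - x%:P) ^+ k) /\ exists l, ~~ root (Q l) x.
Proof.
case=> l; have [N] := ubnP (size (P l)).
elim: N P => // N IHN P sPN P_neq0.
have [[l' nl']|allroot] : (exists l', ~~ root (P l') x) \/ (forall l', root (P l') x).
  case: (boolP [exists l', ~~ root (P l') x]) => [/existsP|/existsPn h]; first by left.
  by right=> l'; move: (h l'); rewrite negbK.
  by exists 0%N, P; split; [move=> ?; rewrite expr0 mulr1 | exists l'].
pose P' l := P l %/ ('X - x%:P).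
have PE l' : P l' = P' l' * ('X - x%:P).
  by rewrite divpK // dvdp_XsubCl.
have P'0 : P' l != 0 by apply: contra P_neq0 => /eqP e; rewrite PE e mul0r.
have [|k [Q [QE nr]]] := IHN P' _ P'0.
  by move: sPN; rewrite PE size_Mmonic ?monicXsubC // size_XsubC addn2 /= ltnS.
by exists k.+1, Q; split=> // l'; rewrite PE QE exprSr mulrA.
Qed.

Lemma mup_basic_poly_real_even p (x : R) :
  p != 0 -> ~~ odd (mup x%:C (basic_poly p)).
Proof.
move=> p_neq0.
have /(factor_common x)[k [Q [QE [l0 nr]]]] : exists l, qcomp p l != 0.
  apply/existsP; apply: contraNT p_neq0 => /existsPn h.
  rewrite -lead_coef_eq0 lead_coefE; case sp: (size p) => [|s] /=.
    by rewrite nth_default // sp.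
  have h' l : (qcomp p l)`_s = 0 by move: (h l); rewrite negbK => /eqP->; rewrite coef0.
  move: (h' (inord 0)) (h' (inord 1)) (h' (inord 2)) (h' (inord 3)).
  rewrite !coef_poly sp ltnSn !inordK //= => e0 e1 e2 e3.
  by apply/eqP/quatP.
rewrite basic_poly_sqr.
have -> : \sum_l qcomp p l ^+ 2 = (\sum_l Q l ^+ 2) * ('X - x%:P) ^+ k.*2.
  rewrite mulr_suml; apply: eq_bigr => l _.
  by rewrite QE exprMn -exprM muln2.
rewrite rmorphM rmorphXn /= map_polyXsubC mupMr ?mup_XsubCX ?eqxx ?odd_double //.
rewrite fmorph_root /root horner_sum; apply/negP => /eqP.
under eq_bigr do rewrite horner_exp.
move=> /psumr_eq0P h; move: nr; rewrite /root.
by rewrite -sqrf_eq0 h ?eqxx // => l _; exact: sqr_ge0.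
Qed.

End QuatPoly.

(* Main.v *)
Require Import Defs.
From mathcomp Require Import all_boot all_order all_algebra.
From mathcomp Require Import reals.
From mathcomp Require Import boolp complex ring lra.
Import Order.TTheory GRing.Theory Num.Theory.
Local Open Scope ring_scope.
Local Open Scope complex_scope.
Set Implicit Arguments.
Unset Strict Implicit.
Unset Printing Implicit Defensive.

(** The basic polynomial F has leading coefficient |A_n|^2 and constant term
    |A_0|^2, so Vieta's formula gives |A_0|^2 = |A_n|^2 * (product of its 2n
    complex roots up to sign). It remains to see that the complex roots of F
    are exactly the pairs z, z^* with z = Sc v + i |Vec v|, for v in the given
    set of roots; since z * z^* = |v|^2, the product of the roots is then the
    square of the product of the |v|, and taking square roots concludes.

    Roots of p and of F are compared one sphere at a time. All quaternions w
    with Sc w = Re z and |Vec w| = |Im z| satisfy the same real quadratic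
    equation as z, namely t^2 = 2 (Re z) t - |z|^2. Reducing p modulo this
    quadratic gives p(w) = a w + b on the whole sphere, and
    F(z) = |a|^2 z^2 + 2 <a, b> z + |b|^2 for the same a and b
    ([sphere_remainder]). This linear form explains everything:
    - a root w = - a^-1 b of p makes the quadratic vanish at z
      ([basic_poly_root]);
    - conversely, if F(z) = 0 then either a = b = 0 and p vanishes on the
      sphere, or the quadratic has roots z and z^*, which forces - a^-1 b to
      lie on the sphere ([basic_poly_root_lift]);
    - two distinct roots on one sphere force a = b = 0, so the sphere is
      spherical ([two_roots_spherical]).
    Hence a sphere that meets the roots of p is either spherical or contains
    one isolated root, and in both cases the definition of a set of roots
    provides the number of its members in that sphere: the multiplicity of z in
    F, or half of it if z is real ([count_root_to_complex]). As F is real, z and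
    z^* have the same multiplicity, so the multiset of all z, z^* is the
    multiset of roots of F ([count_conj_pairs]). *)

(** * The Euclidean structure of the quaternions *)

Section Quaternions.
Variable R : realType.
Implicit Types (w u v : quat R) (x : R).

Definition qdot u v : R :=
  qx0 u * qx0 v + qx1 u * qx1 v + qx2 u * qx2 v + qx3 u * qx3 v.
Definition qreal x : quat R := Quat x 0 0 0.

Lemma qdot_ge0 w : 0 <= qdot w w.
Proof. by rewrite /qdot -!expr2 !addr_ge0 ?sqr_ge0. Qed.

Lemma qdot_eq0 w : (qdot w w == 0) = (w == 0).
Proof.
apply/eqP/eqP => [h|->]; last by rewrite /qdot /=; ring.
apply: quatP => /=; apply/eqP; rewrite -sqrf_eq0 eq_le sqr_ge0 andbT.
- by move: h (sqr_ge0 (qx1 w)) (sqr_ge0 (qx2 w)) (sqr_ge0 (qx3 w)); rewrite /qdot; nra.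
- by move: h (sqr_ge0 (qx0 w)) (sqr_ge0 (qx2 w)) (sqr_ge0 (qx3 w)); rewrite /qdot; nra.
- by move: h (sqr_ge0 (qx1 w)) (sqr_ge0 (qx0 w)) (sqr_ge0 (qx3 w)); rewrite /qdot; nra.
- by move: h (sqr_ge0 (qx1 w)) (sqr_ge0 (qx2 w)) (sqr_ge0 (qx0 w)); rewrite /qdot; nra.
Qed.

Lemma qdotM u v : qdot (u * v) (u * v) = qdot u u * qdot v v.
Proof. by rewrite /qdot /=; ring. Qed.

Lemma quat_mul_eq0 u v : u * v = 0 -> u = 0 \/ v = 0.
Proof.
move/eqP; rewrite -qdot_eq0 qdotM mulf_eq0 !qdot_eq0.
by case/orP => /eqP; [left | right].
Qed.

Lemma sqr_qnorm w : qnorm w ^+ 2 = qdot w w.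
Proof.
by rewrite /qnorm sqr_sqrtr ?addr_ge0 ?sqr_ge0 // /qdot -!expr2.
Qed.

Lemma qnorm_ge0 w : 0 <= qnorm w.
Proof. exact: sqrtr_ge0. Qed.

Lemma qdot_sphere w : qdot w w = Sc w ^+ 2 + qnorm (Vec w) ^+ 2.
Proof. by rewrite sqr_qnorm /qdot /Sc /=; ring. Qed.

(** The Cayley-Hamilton relation: its coefficients depend only on the sphere
    of [w], which is what allows a polynomial to be reduced uniformly there. *)
Lemma quat_sqr w : w * w = qreal (2 * Sc w) * w - qreal (qdot w w).
Proof. by apply: quatP; rewrite /qdot /Sc /=; ring. Qed.

End Quaternions.

(** * Reduction of a polynomial on a sphere *)

Section Reduction.
Variable R : realType.
Implicit Types (w u v : quat R) (p : {poly quat R}) (z : R[i]).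
Local Notation rc := (real_complex R).

Definition qx u (l : 'I_4) : R := nth 0 [:: qx0 u; qx1 u; qx2 u; qx3 u] l.

Lemma qxD u v l : qx (u + v) l = qx u l + qx v l.
Proof. by case: l => [[|[|[|[|]]]]]. Qed.

Lemma qx_0 (l : 'I_4) : qx 0 l = 0.
Proof. by case: l => [[|[|[|[|]]]]]. Qed.

Lemma qx_mul_qreal (x : R) u l : qx (u * qreal x) l = x * qx u l.
Proof. by case: l => [[|[|[|[|]]]]] //= ?; rewrite /qx /=; ring. Qed.

Lemma coef_qcomp p l m : (qcomp p l)`_m = qx p`_m l.
Proof.
rewrite coef_poly; case: ltnP => // sm.
by rewrite nth_default // qx_0.
Qed.

Lemma qcompMXaddC p u l : qcomp (p * 'X + u%:P) l = qcomp p l * 'X + (qx u l)%:P.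
Proof.
apply/polyP => m; rewrite coef_qcomp !coefD !coefMX !coefC.
by case: m => [|m] /=; rewrite ?add0r // !addr0 coef_qcomp.
Qed.

(** On the sphere attached to [z], [w] and [z] satisfy the same real quadratic
    equation, so [a * X + b], the remainder of [p] modulo that quadratic,
    computes [p] at every [w]; its four real components compute those of [p] at
    [z], and summing their squares gives the value of the basic polynomial. *)
Lemma sphere_remainder p z : exists a b,
  (forall w, Sc w = complex.Re z -> qnorm (Vec w) ^+ 2 = complex.Im z ^+ 2 -> p.[w] = a * w + b)
  /\ (basic_poly p).[z] =
     (qdot a a)%:C * z ^+ 2 + (2 * qdot a b)%:C * z + (qdot b b)%:C.
Proof.
(* The invariant kept along Horner's scheme is component-wise, because the
   basic polynomial is not additive in [p]. *)
pose N := complex.Re z ^+ 2 + complex.Im z ^+ 2.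
suff [a [b [Hw Hz]]] : exists a b,
    (forall w, Sc w = complex.Re z -> qnorm (Vec w) ^+ 2 = complex.Im z ^+ 2 -> p.[w] = a * w + b)
    /\ forall l, (map_poly rc (qcomp p l)).[z] = (qx a l)%:C * z + (qx b l)%:C.
  exists a, b; split => //; rewrite basic_poly_sqr rmorph_sum horner_sum /=.
  under eq_bigr => l _ do rewrite rmorphXn hornerE Hz.
  rewrite !big_ord_recl big_ord0 /qx /qdot /= !(rmorphD, rmorphM) /=.
  by ring.
elim/poly_ind: p => [|p u [a [b [Hw Hz]]]].
  exists 0, 0; split => [w _ _|l]; first by rewrite horner0 mul0r addr0.
  have -> : qcomp (0 : {poly quat R}) l = 0.
    by apply/polyP => m; rewrite coef_qcomp !coef0 qx_0.
  by rewrite rmorph0 horner0 qx_0 rmorph0 mul0r addr0.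
(* (a w + b) w + u with w^2 replaced by (2 Re z) w - N. *)
exists (a * qreal (2 * complex.Re z) + b), (u - a * qreal N); split => [w Hr Hi|l].
  rewrite hornerD hornerMX hornerC (Hw _ Hr Hi) mulrDl -mulrA quat_sqr.
  by rewrite qdot_sphere Hi Hr -/N; apply: quatP => /=; ring.
have z2 : z * z = (2 * complex.Re z)%:C * z - N%:C.
  case: z @N {Hw Hz} => x y /=; apply/eqP; rewrite eq_complex /=.
  by apply/andP; split; apply/eqP; ring.
rewrite qcompMXaddC rmorphD rmorphM /= map_polyX map_polyC /= hornerMXaddC Hz.
rewrite mulrDl -mulrA z2.
have -> : u - a * qreal N = u + a * qreal (- N) by apply: quatP => /=; ring.
rewrite !qxD !qx_mul_qreal !(rmorphD, rmorphM, rmorphN) /=; ring.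
Qed.

(** * Roots of the polynomial and roots of its basic polynomial *)

(** With [b = - a w] the quadratic of [sphere_remainder] becomes
    |a|^2 (X^2 - 2 (Sc w) X + |w|^2), which vanishes at [root_to_complex w]. *)
Lemma basic_poly_root p w : root p w -> root (basic_poly p) (root_to_complex w).
Proof.
have [a [b [Hw Hz]]] := sphere_remainder p (root_to_complex w).
rewrite /root Hz (Hw w) //= => /eqP ab0.
have -> : b = - (a * w) by apply/eqP; rewrite -addr_eq0 addrC ab0.
rewrite {Hw Hz ab0} eq_complex; apply/andP.
have := qdot_sphere w; rewrite /root_to_complex.
move: (qnorm _) => y; rewrite /qdot /Sc /= => /eqP.
rewrite -subr_eq0 => /eqP yE; split; apply/eqP; last by ring.
by rewrite -[RHS](mulr0 (qdot a a)) -[X in _ = _ * X]yE /qdot; ring.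
Qed.

(** The root above [z] is [- a^-1 b] if [a] is nonzero; the real and imaginary
    parts of the quadratic equation say that it has the scalar part and the norm
    of [z]. If [a = 0] then [b = 0] and any point of the sphere will do. For
    real [z] the imaginary part gives no information, but then the quadratic is
    |a z + b|^2 and [z] itself is a root. *)
Lemma basic_poly_root_lift p z : 0 <= complex.Im z -> root (basic_poly p) z ->
  exists2 w, root p w & root_to_complex w = z.
Proof.
have [a [b [Hw Hz]]] := sphere_remainder p z.
case: z Hw Hz => x y /= Hw Hz y0 /rootP; rewrite {}Hz.
move=> /eqP; rewrite eq_complex /= => /andP[/eqP re0 /eqP im0].
have lift w : Sc w = x -> qnorm (Vec w) ^+ 2 = y ^+ 2 -> a * w + b = 0 ->
    exists2 w, root p w & root_to_complex w = x +i* y.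
  move=> wx wy ab0; exists w; first by rewrite /root (Hw w wx wy) ab0.
  rewrite /root_to_complex wx; congr (_ +i* _); apply/eqP.
  by rewrite -(eqrXn2 (n := 2)) ?qnorm_ge0 // wy.
have [y00|yn0] := eqVneq y 0.
  apply: (lift (qreal x)) => //; first by rewrite sqr_qnorm y00 /qdot /=; ring.
  apply/eqP; rewrite -qdot_eq0; apply/eqP; rewrite -[RHS]re0 y00 /qdot /=; ring.
have [a0|an0] := eqVneq a 0.
  have b0 : b = 0.
    by apply/eqP; rewrite -qdot_eq0 -re0 a0 /qdot /=; apply/eqP; ring.
  apply: (lift (Quat x y 0 0)) => //; first by rewrite sqr_qnorm /qdot /=; ring.
  by rewrite a0 b0 mul0r addr0.
have N0 : qdot a a != 0 by rewrite qdot_eq0.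
have xE : qdot a b = - qdot a a * x.
  by apply: (mulfI yn0); move: im0; lra.
have yE : qdot b b = qdot a a * (x ^+ 2 + y ^+ 2).
  by move: re0; rewrite -mulrA xE; lra.
(* - a^-1 b, written through a^-1 = conj a / |a|^2. *)
pose w := qreal (- (qdot a a)^-1) * (qconj a * b).
have wx : Sc w = x.
  have -> : Sc w = - (qdot a a)^-1 * qdot a b by rewrite /qdot /Sc /=; ring.
  by rewrite xE; field.
apply: (lift w) => //.
  have ww : qdot w w = x ^+ 2 + y ^+ 2.
    have aa : qdot (qconj a) (qconj a) = qdot a a by rewrite /qdot /=; ring.
    rewrite /w !qdotM aa yE.
    have -> : qdot (qreal (- (qdot a a)^-1)) (qreal (- (qdot a a)^-1))
       = (qdot a a)^-2 by rewrite {1}/qdot /= expr2 invfM; ring.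
    by field.
  by apply: (addrI (x ^+ 2)); rewrite -ww qdot_sphere wx.
have -> : a * w = qreal (- (qdot a a)^-1 * qdot a a) * b.
  by rewrite {2}/qdot; apply: quatP => /=; ring.
by rewrite mulNr mulVf //; apply: quatP => /=; ring.
Qed.

(** A nonzero [a] would determine the root as [- a^-1 b]; so [a], and then [b],
    vanish. *)
Lemma two_roots_spherical p w w' : root p w -> root p w' -> w' != w ->
  root_to_complex w' = root_to_complex w -> spherical_root p w.
Proof.
move=> pw pw' neq [Sww nww].
have [a [b [Hw _]]] := sphere_remainder p (root_to_complex w).
have Hsphere v : Sc v = Sc w -> qnorm (Vec v) = qnorm (Vec w) ->
    p.[v] = a * v + b.
  by move=> vS vn; apply: (Hw v vS); rewrite vn.
have aw : a * w + b = 0 by rewrite -(Hsphere w) //; exact: (eqP pw).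
have aw' : a * w' + b = 0 by rewrite -(Hsphere w') //; exact: (eqP pw').
have a0 : a = 0.
  have /quat_mul_eq0 [//|/eqP] : a * (w' - w) = 0.
    by rewrite mulrBr; apply/eqP; rewrite subr_eq0 -(inj_eq (addIr b)) aw aw'.
  by rewrite subr_eq0 (negPf neq).
have b0 : b = 0 by rewrite -aw a0 mul0r add0r.
split; first exact: pw.
  2: by move=> v vS vn; rewrite /root (Hsphere v vS vn) a0 b0 mul0r addr0 eqxx.
(* A sphere of radius 0 is a point, which leaves no room for two roots. *)
rewrite lt_neqAle qnorm_ge0 andbT eq_sym; apply: contra neq => /eqP n0.
have Vec0 v : qnorm (Vec v) = 0 -> Vec v = 0.
  by move=> h; apply/eqP; rewrite -qdot_eq0 -sqr_qnorm h expr0n.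
case: (Vec0 w n0) (Vec0 w' (etrans nww n0)) => w1 w2 w3 [v1 v2 v3].
by apply/eqP/quatP; rewrite ?w1 ?w2 ?w3 //.
Qed.

(** * Multiplicities *)

(** A sphere with a root either is spherical, and the third clause of
    [set_of_roots] counts the entries of the list on it, or contains a single
    isolated root, counted by the second clause. A sphere without roots meets
    neither the list nor the roots of the basic polynomial. *)
Lemma count_root_to_complex p (ws : seq (quat R)) z :
  set_of_roots p ws -> 0 <= complex.Im z ->
  count (fun w => root_to_complex w == z) ws =
  if complex.Im z == 0 then (mup z (basic_poly p))./2 else mup z (basic_poly p).
Proof.
move=> [ws_root ws_iso ws_sph] Iz.
have [/(basic_poly_root_lift Iz) [w pw wz]|nz] := boolP (root (basic_poly p) z).
  have -> : (if complex.Im z == 0 then (mup z (basic_poly p))./2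
    else mup z (basic_poly p)) = root_mult p w by rewrite -wz.
  have [sph|iso] := pselect (spherical_root p w).
    rewrite -ws_sph //; apply: eq_count => v.
    by rewrite -wz /root_to_complex eq_complex.
  rewrite -ws_iso //; apply: eq_in_count => v /ws_root pv /=.
  apply/eqP/eqP => [vz|-> //]; apply/eqP/negP => /negP neq.
  by apply: iso; apply: (two_roots_spherical pw pv neq); rewrite vz.
rewrite mupNroot // if_same; apply/eqP; rewrite -leqn0 leqNgt -has_count.
apply/hasPn => v /ws_root /basic_poly_root; apply: contraL => /eqP ->.
by [].
Qed.

Lemma mup_factored z c (rs : seq R[i]) : c != 0 ->
  mup z (c *: \prod_(y <- rs) ('X - y%:P)) = count_mem z rs.
Proof. by move=> c0; rewrite -mul_polyC mupMr ?rootC ?mu_prod_XsubC. Qed.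

(** The coefficients of the basic polynomial are real, so conjugation permutes
    its roots. *)
Lemma mup_conj p z : basic_poly p != 0 ->
  mup (conjc z) (basic_poly p) = mup z (basic_poly p).
Proof.
move=> F0; have [rs Frs] := closed_field_poly_normal (basic_poly p).
have lF0 : lead_coef (basic_poly p) != 0 by rewrite lead_coef_eq0.
have conjF : map_poly conjc (basic_poly p) = basic_poly p.
  by apply/polyP => m; rewrite coef_map basic_poly_sqr coef_map /= oppr0.
rewrite [in RHS]Frs mup_factored // -{1}conjF Frs.
rewrite map_polyZ /= rmorph_prod /=.
under eq_bigr do rewrite map_polyXsubC /=.
rewrite -(big_map conjc xpredT (fun y => 'X - y%:P)) mup_factored.
  by rewrite count_map; apply: eq_count => y /=; rewrite (inj_eq (can_inj (@conjcK R))).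
by rewrite fmorph_eq0.
Qed.

(** For nonreal [z] only one of the two terms is nonzero, as the complex numbers
    [root_to_complex w] lie in the closed upper half plane; for real [z] both
    equal half the multiplicity, which is even. *)
Lemma count_conj_pairs p (ws : seq (quat R)) z : p != 0 -> basic_poly p != 0 ->
  set_of_roots p ws ->
  (count (fun w => root_to_complex w == z) ws
   + count (fun w => root_to_complex w == conjc z) ws)%N = mup z (basic_poly p).
Proof.
move=> p0 F0 hws; wlog Iz : z / 0 <= complex.Im z => [wlg|].
  have [/wlg //|Iz] := leP 0 (complex.Im z).
  rewrite -mup_conj // -wlg; first by rewrite conjcK addnC.
  by case: z Iz => x y /= y0; rewrite oppr_ge0 ltW.
rewrite (count_root_to_complex hws Iz).
have [Iz0|Izn0] := eqVneq (complex.Im z) 0.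
  have zc : conjc z = z by case: z {Iz} Iz0 => x y /= ->; rewrite oppr0.
  rewrite zc (count_root_to_complex hws Iz) Iz0 eqxx addnn.
  have zx : z = (complex.Re z)%:C by case: z {Iz zc} Iz0 => x y /= ->.
  by rewrite even_halfK // zx mup_basic_poly_real_even.
rewrite (eq_count (a2 := pred0)) ?count_pred0 ?addn0 // => w /=.
apply/negP => /eqP /(congr1 (@complex.Im R)) /=.
have := qnorm_ge0 (Vec w); case: z Iz Izn0 => x y /= y0 yn0; move: yn0.
by rewrite neq_lt ltNge y0 /= => y1 ?; lra.
Qed.

(** * Extreme coefficients of the basic polynomial *)

Lemma coef_basic_poly0 p : (basic_poly p)`_0 = (qdot p`_0 p`_0)%:C.
Proof.
rewrite basic_poly_sqr coef_map coef_sum.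
under eq_bigr do rewrite expr2 coef0M coef_qcomp.
by congr (_%:C); rewrite !big_ord_recl big_ord0 /qdot /qx /=; ring.
Qed.

Lemma lead_coef_basic_poly p n : size p = n.+1 ->
  lead_coef (basic_poly p) = (qdot p`_n p`_n)%:C.
Proof.
move=> sp; have top : (basic_poly p)`_(n.*2) = (qdot p`_n p`_n)%:C.
  rewrite coef_poly sp /= ltnSn /Sc /basic_coef sp; congr (_%:C).
  rewrite (bigD1 ord_max) //= (big_pred1 ord_max) => [|r]; last first.
    by rewrite /= -addnn eqn_add2l.
  rewrite big1 ?addr0 => [|d dn]; first by rewrite /qdot /=; ring.
  apply: big_pred0 => r /=; apply/negbTE; rewrite neq_ltn -addnn; apply/orP; left.
  rewrite -addSn leq_add //; last by rewrite -ltnS.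
  by rewrite ltn_neqAle -ltnS ltn_ord andbT.
rewrite -top lead_coefE; have -> // : size (basic_poly p) = n.*2.+1.
apply/eqP; rewrite eqn_leq; apply/andP; split.
  by rewrite /basic_poly sp size_poly.
rewrite ltnNge; apply/negP => /leq_sizeP /(_ _ (leqnn _)) /eqP.
rewrite top fmorph_eq0 qdot_eq0.
have := lead_coef_eq0 p; rewrite lead_coefE sp /= => -> /eqP p0.
by move: sp; rewrite p0 size_poly0.
Qed.

End Reduction.

Theorem theorem3 (R : realType) (n : nat) (hn : (1 <= n)%N)
  (p : {poly quat R}) (hp : size p = n.+1)
  (w : n.-tuple (quat R)) (hw : set_of_roots p w) :
  \prod_(m < n) qnorm (tnth w m) = qnorm p`_0 / qnorm p`_n.
Proof.
have p0 : p != 0 by rewrite -size_poly_eq0 hp.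
have pn0 : qdot p`_n p`_n != 0.
  by rewrite qdot_eq0 -[n]/(n.+1.-1) -hp -lead_coefE lead_coef_eq0.
have leadF := lead_coef_basic_poly hp.
have F0 : basic_poly p != 0 by rewrite -lead_coef_eq0 leadF fmorph_eq0.
have [rs Frs] := closed_field_poly_normal (basic_poly p).
(* The multiset of roots of the basic polynomial. *)
pose zs := [seq root_to_complex v | v <- w] ++
           [seq conjc (root_to_complex v) | v <- w].
have rs_zs : perm_eq rs zs.
  apply/allP => z _ /=; apply/eqP.
  transitivity (mup z (basic_poly p)).
    by rewrite Frs mup_factored // leadF fmorph_eq0.
  rewrite -(count_conj_pairs z p0 F0 hw) count_cat !count_map.
  congr (_ + _)%N; apply: eq_count => v //=.
  by rewrite -(inj_eq (can_inj (@conjcK R))) conjcK.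
have: (qdot p`_0 p`_0)%:C = (qdot p`_n p`_n * \prod_(v <- w) qdot v v)%:C.
  rewrite -coef_basic_poly0 -horner_coef0 Frs leadF hornerZ horner_prod.
  rewrite (perm_big _ rs_zs) big_cat !big_map /= -big_split /= rmorphM rmorph_prod /=.
  congr (_ * _); apply: eq_bigr => v _; rewrite !hornerE qdot_sphere.
  by apply/eqP; rewrite eq_complex /=; apply/andP; split; apply/eqP; ring.
move=> /(fmorph_inj (real_complex R)) eq_sq.
apply/eqP; rewrite -(eqrXn2 (n := 2)) ?divr_ge0 ?prodr_ge0 ?qnorm_ge0 //; last first.
  by move=> m _; exact: qnorm_ge0.
rewrite exprMn exprVn !sqr_qnorm eq_sq -prodrXl.
rewrite [_ * \prod_(_ <- _) _]mulrC mulfK //.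
by rewrite big_tuple; apply/eqP/eq_bigr => v _; rewrite sqr_qnorm.
Qed.
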